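(* Let $p$ be a prime, $d_1\geq d_2\geq 0$ and $0\leq m<p^{d_2}$ integers, let $I$ be the subgroup of $\mathbb{Z}^2$ generated by $(p^{d_1},m)$ and $(0,p^{d_2})$, and let $A=\mathbb{Z}^2/I$. Then $$\sigma_{a+I}(b+I)=(b_1+1,\ a_1+b_1+b_2)+I,\qquad a=(a_1,a_2),\ b=(b_1,b_2)\in\mathbb{Z}^2,$$ yields an involutive solution $(A,r)\in \mathbf{AbSol}(p^{d_1},p^{d_2})$. Moreover, every solution in $\mathbf{AbSol}(p^{d_1},p^{d_2})$ is isomorphic to such a solution for a unique choice of $d_1,d_2$ and $m$.
   Context: A solution is a pair $(X,r)$ with $X$ a nonempty set and $r:X^2\to X^2$ a bijection, $r(x,y)=(\sigma_x(y),\tau_y(x))$, satisfying the braid equation $(r\times \mathrm{id})(\mathrm{id}\times r)(r\times \mathrm{id})=(\mathrm{id}\times r)(r\times \mathrm{id})(\mathrm{id}\times r)$ with all $\sigma_x,\tau_x$ bijective. It is involutive if $r^2=\mathrm{id}$; in that case $r$ is determined by the maps $\sigma_x$ through $r(x,y)=(\sigma_x(y),\sigma^{-1}_{\sigma_x(y)}(x))$. It is indecomposable if the group generated by all $\sigma_x,\tau_x$ is transitive on $X$; its permutation group is $\langle(\sigma_x,\tau_x^{-1})\mid x\in X\rangle$. Isomorphisms $(X,r)\to(Y,s)$ are bijections $f$ with $(f\times f)r=s(f\times f)$. $\mathrm{Ret}(X,r)$ is the induced solution on $X/{\sim}$, where $x\sim y$ iff $\sigma_x=\sigma_y$ and $\tau_x=\tau_y$;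 $\mathrm{Ret}^0(X,r)=(X,r)$. $\mathbf{AbSol}(m_1,m_2)$ consists of the finite indecomposable involutive solutions $(X,r)$ with abelian permutation group such that $|\mathrm{Ret}^{i-1}(X,r)|/|\mathrm{Ret}^{i}(X,r)|=m_i$ for $i=1,2$ and $|\mathrm{Ret}^2(X,r)|=1$. *)

(* Defs.v *)
From HB Require Import structures.
From mathcomp Require Import all_boot all_order all_algebra all_fingroup.
From mathcomp Require Import boolp.

(* After all_fingroup, which shadows [repr]. *)
From mathcomp Require Import generic_quotient.

Set Implicit Arguments.
Unset Strict Implicit.
Unset Printing Implicit Defensive.

Import GRing.Theory.

Local Open Scope quotient_scope.

(* A finite set with an arbitrary map r : X^2 -> X^2; the axioms of a solution
   are imposed separately by [is_solution]. *)
Record quadratic_set := QuadraticSet {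
  carrier :> finType;
  qmap : carrier * carrier -> carrier * carrier }.

Section Solutions.

Variable S : quadratic_set.
Local Notation r := (@qmap S).

Definition sigma (x y : S) : S := (r (x, y)).1.

(* [tau y x] is tau_y(x): the index is the second argument of r. *)
Definition tau (y x : S) : S := (r (x, y)).2.

Definition r12 (u : S * S * S) : S * S * S :=
  let v := r (u.1.1, u.1.2) in (v.1, v.2, u.2).

Definition r23 (u : S * S * S) : S * S * S :=
  let v := r (u.1.2, u.2) in (u.1.1, v.1, v.2).

Definition braid_equation : Prop :=
  forall u, r12 (r23 (r12 u)) = r23 (r12 (r23 u)).

Definition is_solution : Prop :=
  [/\ 0 < #|S|, bijective r, braid_equation,
      forall x, bijective (sigma x) & forall y, bijective (tau y)].

Definition involutive_solution : Prop :=
  is_solution /\ (forall u, r (r u) = u).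

Definition translations : {set {perm S}} :=
  [set g : {perm S} | [exists x, [forall y, g y == sigma x y]
                              || [forall y, g y == tau x y]]].

Definition indecomposable : Prop :=
  [transitive <<translations>>%g, on [set: S] | 'P]%act.

(* The pair g is (sigma_x, tau_x^-1) iff g.1 = sigma_x and g.2 is a left
   inverse of tau_x. *)
Definition permutation_group : {group ({perm S} * {perm S})} :=
  <<[set g : {perm S} * {perm S} |
      [exists x, [forall y, (g.1 y == sigma x y) && (g.2 (tau x y) == y)]]]>>%G.

Definition ret_rel : rel S :=
  fun x y => [forall z, (sigma x z == sigma y z) && (tau x z == tau y z)].

Lemma ret_relP x y :
  reflect (sigma x =1 sigma y /\ tau x =1 tau y) (ret_rel x y).
Proof.
apply: (iffP forallP) => [h|[h1 h2] z]; last by rewrite h1 h2 !eqxx.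
by split=> z; case/andP: (h z) => /eqP ? /eqP ?.
Qed.

Lemma ret_rel_refl : reflexive ret_rel.
Proof. by move=> x; apply/ret_relP. Qed.

Lemma ret_rel_sym : symmetric ret_rel.
Proof.
by move=> x y; apply/ret_relP/ret_relP => -[h1 h2]; split=> z;
  rewrite ?h1 ?h2.
Qed.

Lemma ret_rel_trans : transitive ret_rel.
Proof.
move=> y x z /ret_relP[h1 h2] /ret_relP[k1 k2].
by apply/ret_relP; split=> t; rewrite ?h1 ?h2.
Qed.

Canonical ret_equiv := EquivRel ret_rel ret_rel_refl ret_rel_sym ret_rel_trans.

Definition ret_quot := {eq_quot ret_equiv}.

HB.instance Definition _ := EqQuotient.on ret_quot.
HB.instance Definition _ := Choice.on ret_quot.
HB.instance Definition _ :=
  Countable.copy ret_quot (can_type (@reprK _ ret_quot)).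
HB.instance Definition _ : isFinite ret_quot := CanIsFinite (@reprK _ ret_quot).

(* The map is computed on representatives; [Ret_qmap_pi] shows that for a
   solution the result does not depend on them. *)
Definition Ret : quadratic_set :=
  @QuadraticSet ret_quot (fun u =>
    (\pi_ret_quot (sigma (repr u.1) (repr u.2)),
     \pi_ret_quot (tau (repr u.2) (repr u.1)))).

Lemma Ret_qmap_pi (x y : S) : is_solution ->
  @qmap Ret (\pi_ret_quot x, \pi_ret_quot y) =
  (\pi_ret_quot (sigma x y), \pi_ret_quot (tau y x)).
Proof.
case=> _ _ br bs bt /=.
have r_st a b : r (a, b) = (sigma a b, tau b a).
  by rewrite /sigma /tau; case: (r _).
have br1 a b c : sigma (sigma a b) (sigma (tau b a) c) = sigma a (sigma b c).
  by have := br (a, b, c); rewrite /r12 /r23 /= !r_st /= => -[].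
have br3 a b c : tau c (tau b a) = tau (tau c b) (tau (sigma b c) a).
  by have := br (a, b, c); rewrite /r12 /r23 /= !r_st /= => -[].
have sE a b b' : ret_rel b b' -> ret_rel (sigma a b) (sigma a b').
  case/ret_relP=> sb tb; apply/ret_relP; split=> z.
    have [g _ gK] := bs (tau b a).
    by rewrite -(gK z) br1 sb -br1 tb.
  by apply: (bij_inj (bt (tau b a))); rewrite -br3 !tb -br3.
have tE b a a' : ret_rel a a' -> ret_rel (tau b a) (tau b a').
  case/ret_relP=> sa ta; apply/ret_relP; split=> z.
    by apply: (bij_inj (bs (sigma a b))); rewrite br1 !sa -br1.
  have [g _ gK] := bt (sigma a b).
  by rewrite -(gK z) -br3 ta br3 sa.
have reprE a : ret_rel (repr (\pi_ret_quot a)) a.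
  by apply/eqmodP; rewrite reprK.
set x' := repr _; set y' := repr _.
have [/ret_relP[sx tx] /ret_relP[sy ty]] := (reprE x, reprE y).
congr (_, _); apply/eqmodP.
  by rewrite /= sx; apply: sE; apply: reprE.
by rewrite /= ty; apply: tE; apply: reprE.
Qed.

End Solutions.

Definition isomorphic (S T : quadratic_set) : Prop :=
  exists2 f : S -> T, bijective f &
    forall u : S * S, (f (qmap u).1, f (qmap u).2) = qmap (f u.1, f u.2).

Definition ret_card (S : quadratic_set) (i : nat) : nat := #|iter i Ret S|.

(* Cardinalities are divided in rat, since division on nat truncates. *)
Definition AbSol (m1 m2 : nat) (S : quadratic_set) : Prop :=
  [/\ involutive_solution S, indecomposable S, abelian (permutation_group S),
      ((ret_card S 0)%:Q / (ret_card S 1)%:Q = m1%:Q)%R /\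
      ((ret_card S 1)%:Q / (ret_card S 2)%:Q = m2%:Q)%R
    & ret_card S 2 = 1].

(* r(x, y) = (sigma_x(y), sigma^-1_{sigma_x(y)}(x)) for sigma = s. *)
Definition involutive_qset (X : finType) (s : X -> {perm X}) : quadratic_set :=
  @QuadraticSet X (fun u => (s u.1 u.2, (s (s u.1 u.2))^-1%g u.1)).

Section Lattice.

Local Open Scope ring_scope.

Variables (p : nat) (p_pr : prime p) (d1 d2 m : nat).

(* Boolean membership in the subgroup of int * int spanned by (p^d1, m) and
   (0, p^d2). *)
Definition lattice : pred (int * int) := fun v =>
  `[< inIntSpan [tuple ((p ^ d1)%:Z, m%:Z); (0, (p ^ d2)%:Z)] v >].

Lemma lattice_zmod_closed : zmod_closed lattice.
Proof.
split=> [|u v /asboolP[a ->] /asboolP[b ->]]; apply/asboolP.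
  by exists [ffun _ => 0]; rewrite big1 // => i _; rewrite ffunE mulr0z.
exists [ffun i => a i - b i]; rewrite -sumrB.
by apply: eq_bigr => i _; rewrite ffunE mulrzBr.
Qed.

HB.instance Definition _ :=
  GRing.isZmodClosed.Build (int * int)%type lattice lattice_zmod_closed.

(* Primality of p is an argument because finiteness of the quotient needs
   p > 0. *)
Definition lattice_quot of prime p :=
  Quotient.quot (GRing.ZmodClosed.clone (int * int)%type lattice _).

Local Notation A := (lattice_quot p_pr).

HB.instance Definition _ := GRing.Zmodule.on A.
HB.instance Definition _ := EqQuotient.on A.

Definition lattice_class (i : 'I_(p ^ d1) * 'I_(p ^ d2)) : A :=
  \pi_A ((i.1 : nat)%:Z, (i.2 : nat)%:Z).

Lemma lattice_class_surj (x : A) : x \in codom lattice_class.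
Proof.
have rem (z : int) d : exists (i : 'I_(p ^ d)) (k : int),
    z = k * (p ^ d)%:Z + (i : nat)%:Z.
  have q_gt0 : (0 < p ^ d)%N by rewrite expn_gt0 prime_gt0.
  have q_neq0 : (p ^ d)%:Z != 0 by rewrite eqz_nat -lt0n.
  have lt_q : (`|(z %% (p ^ d)%:Z)%Z| < p ^ d)%N.
    by rewrite -ltz_nat gez0_abs ?modz_ge0 // ltz_pmod.
  exists (Ordinal lt_q), (z %/ (p ^ d)%:Z)%Z.
  by rewrite /= gez0_abs ?modz_ge0 // -divz_eq.
have [i [k e1]] := rem (repr x).1 d1.
have [j [l e2]] := rem ((repr x).2 - k * m%:Z) d2.
apply/codomP; exists (i, j); rewrite -[x]reprK /lattice_class /=.
apply/eqP; rewrite -Quotient.idealrBE; apply/asboolP.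
exists [ffun n : 'I_2 => [:: k; l]`_n].
rewrite big_ord_recl big_ord1 !ffunE /=.
move: e1 e2; case: (repr x) => a b /= e1 e2.
have -> : b = k * m%:Z + (l * (p ^ d2)%:Z + (j : nat)%:Z).
  by rewrite -e2 addrC subrK.
have pairMz (u : int * int) (z : int) : u *~ z = (z * u.1, z * u.2).
  rewrite [LHS]surjective_pairing (raddfMz fst) (raddfMz snd).
  by rewrite /= !mulrzz ![z * _]mulrC.
rewrite e1 !pairMz; congr (_, _); rewrite /=.
  by rewrite addrK mulr0 addr0.
by rewrite addrA addrK.
Qed.

HB.instance Definition _ :=
  Countable.copy A (can_type (fun x => f_iinv (lattice_class_surj x))).
HB.instance Definition _ : isFinite A :=
  CanIsFinite (fun x => f_iinv (lattice_class_surj x)).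

(* [s] is the family of maps sigma of the solution on Z^2/I; being stated on all
   representatives, the equation includes the fact that it is well defined. *)
Definition lattice_sigma (s : A -> {perm A}) : Prop :=
  forall a b : int * int,
    s (\pi_A a) (\pi_A b) = \pi_A (b.1 + 1, a.1 + b.1 + b.2).

End Lattice.

(* Main.v *)
Require Import Defs.
From mathcomp Require Import all_boot all_algebra all_fingroup.
From mathcomp Require Import cyclic boolp ring zify.
From mathcomp Require Import generic_quotient.

(* Let (X, r) be in AbSol(q1, q2).  Since Ret^2 is trivial, the class of
   sigma_x(y) in Ret does not depend on x; the braid equation and commutativity
   then make Z = sigma_{sigma_x(y)} sigma_y^-1 a constant permutation.  Fix a base
   point x0 and put T = sigma_{x0}: every sigma_x is Z^a T for some a, every point
   is T^a Z^b x0, and sigma_{T^a Z^b x0} = Z^a T.  The abelian group <T, Z> acts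
   regularly, Z has order |Ret X| = q2 and T^q1 = Z^n, so the integers q1, q2, n
   determine the solution up to isomorphism.  They are invariants, because Z does
   not depend on x0 and T^q1 does not either when q2 divides q1.  In the lattice
   solution Z is (b1, b2) -> (b1, b2 + 1) and
   T^k (b1, b2) = (b1 + k, b2 + k b1 + C(k, 2)), hence n = C(q1, 2) - m mod q2, and
   every residue n arises from exactly one m. *)

Set Implicit Arguments.
Unset Strict Implicit.
Unset Printing Implicit Defensive.

Import GRing.Theory.

Local Open Scope quotient_scope.
Local Open Scope group_scope.

(* Here [(Z * s y)^-1] is the [(s (s x y))^-1] of the formula for an involutive
   solution, rewritten with the third clause. *)
Definition presented (S : quadratic_set) (s : S -> {perm S}) (Z : {perm S})
    (x0 : S) : Prop :=
  [/\ forall x y, qmap (x, y) = (s x y, (Z * s y)^-1 x),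
      forall x y, commute (s x) (s y),
      forall x y, s (s x y) = Z * s y
    & forall P : pred S, P x0 -> (forall x y, P y -> P (s x y)) ->
        forall y, P y].

(** * Coordinates on a presented solution and its membership in [AbSol] *)

Section Presented.

Variables (S : quadratic_set) (s : S -> {perm S}) (Z : {perm S}) (x0 : S).
Hypothesis pres : presented s Z x0.

Local Notation T := (s x0).

Let qmapE x y : qmap (x, y) = (s x y, (Z * s y)^-1 x).
Proof. by case: pres. Qed.
Let s_comm x y : commute (s x) (s y). Proof. by case: pres. Qed.
Let s_s x y : s (s x y) = Z * s y. Proof. by case: pres. Qed.

Lemma presented_ZE x y : Z = s (s x y) * (s y)^-1.
Proof. by rewrite s_s mulgK. Qed.

Lemma presented_commZ x : commute Z (s x).
Proof.
rewrite (presented_ZE x0 x0); apply/commute_sym; apply: commuteM => //.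
exact/commuteV.
Qed.

Lemma presented_sV x y : s ((s x)^-1 y) = Z^-1 * s y.
Proof. by rewrite -[y in RHS](permKV (s x)) s_s mulKg. Qed.

(** [Z] is a quotient of two values of [s]: one of them multiplies [s y] by [Z], the inverse of the
    other by [Z^-1], and the two factors cancel. *)
Lemma presented_sZ y : s (Z y) = s y.
Proof. by rewrite {1}(presented_ZE x0 x0) permM presented_sV s_s mulKg. Qed.

Lemma presented_sX k x y : s ((s x ^+ k) y) = Z ^+ k * s y.
Proof.
elim: k y => [|k IHk] y; first by rewrite !expg0 mul1g perm1.
by rewrite expgS permM IHk s_s mulgA -expgSr.
Qed.

Lemma presented_sZX k y : s ((Z ^+ k) y) = s y.
Proof.
elim: k y => [|k IHk] y; first by rewrite expg0 perm1.
by rewrite expgS permM IHk presented_sZ.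
Qed.

Definition point a b : S := (T ^+ a * Z ^+ b) x0.

Lemma s_point a b : s (point a b) = Z ^+ a * T.
Proof. by rewrite /point permM presented_sZX presented_sX. Qed.

Lemma commTZ a b : commute (T ^+ a) (Z ^+ b).
Proof. exact/commuteX2/commute_sym/presented_commZ. Qed.

Lemma presented_sE x : exists a, s x = Z ^+ a * T.
Proof.
have [_ _ _ clos] := pres; apply/asboolP; move: x.
apply: clos => [|x y /asboolP[a sy]]; apply/asboolP.
  by exists 0; rewrite expg0 mul1g.
by exists a.+1; rewrite s_s sy mulgA -expgS.
Qed.

(** With [s_point], this makes every sigma map explicit in the coordinates; [point_surj] and
    [presented_isomorphic] both rest on it. *)
Lemma act_point a a' b' : (Z ^+ a * T) (point a' b') = point a'.+1 (b' + a).
Proof.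
have cT i : T * Z ^+ i = Z ^+ i * T := commTZ 1 i.
by rewrite /point -permM expgSr expgD -cT !mulgA -(mulgA _ _ T) -cT !mulgA.
Qed.

Lemma point_surj y : exists a b, y = point a b.
Proof.
have [_ _ _ clos] := pres; apply/asboolP; move: y.
apply: clos => [|x y /asboolP[a' [b' ->]]]; apply/asboolP.
  by exists 0, 0; rewrite /point !expg0 mulg1 perm1.
by have [a ->] := presented_sE x; rewrite act_point; exists a'.+1, (b' + a)%N.
Qed.

(** A transitive abelian group acts freely: two of its elements agreeing at [x0] agree at every
    translate of [x0], by commutation. *)
Lemma point_inj a b a' b' :
  point a b = point a' b' -> T ^+ a * Z ^+ b = T ^+ a' * Z ^+ b'.
Proof.
move=> eq_pt; apply/permP=> y; have [c [d ->]] := point_surj y.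
have commC i j : commute (T ^+ i * Z ^+ j) (T ^+ c * Z ^+ d).
  apply: commuteM; apply/commute_sym; apply: commuteM.
  - exact/commuteX2/commute_refl.
  - exact: commTZ.
  - exact/commute_sym/commTZ.
  - exact/commuteX2/commute_refl.
rewrite -[_ (point c d)]permM -[RHS]permM -!commC.
by rewrite (permM (T ^+ a * _)) (permM (T ^+ a' * _)) -/(point a b) eq_pt.
Qed.

(** Evaluation at [x0] is a bijection from [<[T]> * <[Z]>] onto [S], so this product has [q1 * q2]
    elements. By the product formula [<[T]> :&: <[Z]>] then has index [q1] in [<[T]>], and [T ^+ q1]
    dies in the quotient. *)
Lemma presented_exp_index q1 q2 :
  #|S| = (q1 * q2)%N -> #[Z] = q2 -> T ^+ q1 \in <[Z]>.
Proof.
move=> cardS ordZ.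
have cardTZ : #|<[T]> * <[Z]>| = (q1 * q2)%N.
  rewrite -cardS -cardsT -(card_in_imset (f := fun u : {perm S} => u x0)).
    apply: eq_card => y; rewrite inE; apply/imsetP.
    have [a [b ->]] := point_surj y.
    by exists (T ^+ a * Z ^+ b); rewrite ?mem_mulg ?mem_cycle.
  by move=> _ _ /mulsgP[_ _ /cycleP[a ->] /cycleP[b ->] ->]
    /mulsgP[_ _ /cycleP[a' ->] /cycleP[b' ->] ->] /point_inj.
set K := <[T]> :&: <[Z]>.
have nKT : T \in 'N(K).
  have /subsetP : <[T]> \subset 'N(K).
    by rewrite sub_abelian_norm ?cycle_abelian ?subsetIl.
  by apply; apply: cycle_id.
have indexK : #|<[T]> : K| = q1.
  have := mul_cardG <[T]> <[Z]>.
  rewrite cardTZ -(Lagrange (subsetIl <[T]> <[Z]>)) -/K -[#|<[Z]>|]/(#[Z]) ordZ.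
  have K_gt0 : 0 < #|K| by apply: cardG_gt0.
  have Z_gt0 : 0 < q2 by rewrite -ordZ order_gt0.
  rewrite [RHS]mulnC mulnA => /eqP.
  by rewrite eqn_pmul2r // eqn_pmul2l // => /eqP.
suff: T ^+ q1 \in K by case/setIP.
rewrite -indexK coset_idr ?groupX // morphX //= -card_quotient; last first.
  by rewrite sub_abelian_norm ?cycle_abelian ?subsetIl.
by rewrite expg_cardG // mem_quotient // cycle_id.
Qed.

Lemma sigmaE x y : sigma x y = s x y.
Proof. by rewrite /sigma qmapE. Qed.

Lemma tauE x y : tau x y = (Z * s x)^-1 y.
Proof. by rewrite /tau qmapE. Qed.

Lemma ret_relE (x y : S) : ret_rel x y = (s x == s y).
Proof.
apply/ret_relP/eqP => [[sxy _] | sxy].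
  by apply/permP=> z; rewrite -!sigmaE.
by split=> z; rewrite ?sigmaE ?tauE sxy.
Qed.

(** A class of [Ret S] is determined by its value of [s], and by [s_point] these values fill the
    coset of [<[Z]>] through [T]. *)
Lemma card_Ret : #|Ret S| = #[Z].
Proof.
rewrite -cardsT -(card_imset (f := fun q : ret_quot S => s (repr q))).
  rewrite orderE -(card_rcoset <[Z]> T); apply: eq_card => u.
  apply/imsetP/rcosetP => [[q _ ->] | [_ /cycleP[k ->] ->]].
    have [a [b ->]] := point_surj (repr q).
    by exists (Z ^+ a); rewrite ?mem_cycle ?s_point.
  exists (\pi_(ret_quot S) (point k 0)) => //.
  rewrite -(s_point k 0); apply/eqP; rewrite -ret_relE.
  have /eqmodP/= := reprK (\pi_(ret_quot S) (point k 0)).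
  by rewrite ret_rel_sym.
move=> q q' /= eq_s; rewrite -[q]reprK -[q']reprK; apply/eqmodP => /=.
by rewrite ret_relE eq_s.
Qed.

Lemma s_tau x y : s ((Z * s x)^-1 y) = Z^-1 * s y.
Proof. by rewrite invMg permM -presented_sZ permKV presented_sV. Qed.

Lemma presented_involutive : involutive_solution S.
Proof.
have rK : involutive (@qmap S).
  by move=> [x y]; rewrite !qmapE s_tau s_s permKV mulKVg permK.
have tau_inj (y : S) : injective (tau y).
  by move=> x x'; rewrite !tauE => /perm_inj.
split=> //; split.
- by apply/card_gt0P; exists x0.
- exact: inv_bij.
(* By [s_s] and [s_tau] every nested index contributes only a power of [Z], so each component of the
   braid equation becomes an identity between commuting permutations. *)
- have r_st (x y : S) : qmap (x, y) = (s x y, tau y x) by rewrite qmapE tauE.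
  have cZ := presented_commZ.
  case=> -[x y] z; rewrite /r12 /r23 /= !r_st /= !tauE !s_tau !s_s.
  congr (_, _, _); rewrite -!permM.
  + by rewrite mulgA -(mulgA _ (s x)) -cZ mulKg s_comm.
  + rewrite (permM Z^-1 (s x) z) s_s -(presented_sZ (Z^-1 z)) permKV invMg.
    rewrite [in RHS]mulgA; suff <- : commute (s x) ((Z * s z)^-1 * Z^-1) by [].
    by apply: commuteM; apply: commuteV; rewrite /commute ?mulgA -?cZ -?mulgA;
       rewrite 1?s_comm // mulgA -cZ mulgA.
  + rewrite mulKVg -!invMg;
    suff -> : Z * s z * (Z * s y) = s y * (Z * (Z * s z)) by [].
    by rewrite mulgA -(mulgA Z (s z)) -cZ; apply/commute_sym; apply: commuteM;
       [exact/commute_sym | apply: commuteM => //; exact/commute_sym].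
- by move=> x; apply/injF_bij => y z; rewrite !sigmaE => /perm_inj.
- by move=> x; apply/injF_bij.
Qed.

Lemma presented_indecomposable : indecomposable S.
Proof.
have [_ _ _ clos] := pres.
apply/imsetP; exists x0 => //; apply/esym/setP => y; rewrite [RHS]inE.
move: y; apply: clos => [|x y /=]; first exact: orbit_refl.
move=> /orbitP[g Gg <-]; apply/orbitP; exists (g * s x); last by rewrite actM.
rewrite groupM // mem_gen // inE; apply/existsP; exists x.
by apply/orP; left; apply/forallP=> z; rewrite sigmaE.
Qed.

Lemma presented_abelian : abelian (permutation_group S).
Proof.
rewrite abelian_gen; apply/centsP => u; rewrite inE => /existsP[x /forallP ux].
move=> v; rewrite inE => /existsP[y /forallP vy].
(* The inverse of [tau z] is [Z * s z], which identifies the generators. *)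
have uvE (w : {perm S} * {perm S}) z :
    (forall t, (w.1 t == sigma z t) && (w.2 (tau z t) == t)) ->
  w = (s z, Z * s z).
  move=> wz; rewrite [w]surjective_pairing; congr (_, _); apply/permP=> t.
    by have /andP[/eqP-> _] := wz t; rewrite sigmaE.
  by have /andP[_ /eqP] := wz ((Z * s z) t); rewrite tauE permK.
rewrite (uvE u x) // (uvE v y) // /commute /mulg /=.
have cZ z := presented_commZ z.
congr (_, _); first exact: s_comm.
by apply: commuteM; apply/commute_sym; apply: commuteM => //; apply/commute_sym.
Qed.

(** The values [s (s x y) = Z * s y] and [s (tau x y) = Z^-1 * s y] do not involve [x]. Hence on
    [Ret S] the maps sigma and tau are independent of their index, and a second retraction
    identifies all classes. *)
Lemma presented_ret_card2 : ret_card S 2 = 1%N.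
Proof.
have [solS _] := presented_involutive.
apply/eqP/fintype1P; exists (\pi_(ret_quot (Ret S)) (\pi_(ret_quot S) x0)) => q.
rewrite -[q](@reprK _ (ret_quot (Ret S))) -[repr q](@reprK _ (ret_quot S)).
apply/eqmodP/ret_relP.
have sigma_pi (x y : S) :
    sigma (\pi_(ret_quot S) x : Ret S) (\pi_(ret_quot S) y) =
    \pi_(ret_quot S) (sigma x y).
  by rewrite {1}/sigma Ret_qmap_pi.
have tau_pi (x y : S) :
    tau (\pi_(ret_quot S) x : Ret S) (\pi_(ret_quot S) y) =
    \pi_(ret_quot S) (tau x y).
  by rewrite {1}/tau Ret_qmap_pi.
split=> t; rewrite -[t](@reprK _ (ret_quot S)) ?sigma_pi ?tau_pi;
  apply/eqmodP => /=.
  by rewrite ret_relE !sigmaE !s_s.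
by rewrite ret_relE !tauE !s_tau.
Qed.

Lemma presented_AbSol q1 q2 :
  #|S| = (q1 * q2)%N -> #[Z] = q2 -> AbSol q1 q2 S.
Proof.
move=> cardS ordZ.
split; [exact: presented_involutive | exact: presented_indecomposable
  | exact: presented_abelian | | exact: presented_ret_card2].
rewrite presented_ret_card2 /ret_card /= card_Ret ordZ cardS.
split; last by rewrite divr1.
by rewrite PoszM rmorphM /= mulfK // intr_eq0 eqz_nat -ordZ -lt0n order_gt0.
Qed.

End Presented.

(** * Every member of [AbSol] has a presentation *)

Lemma AbSol_presented q1 q2 (S : quadratic_set) :
  0 < q2 -> AbSol q1 q2 S ->
  exists s Z x0,
    [/\ presented (S := S) s Z x0, #|S| = (q1 * q2)%N & #[Z] = q2].
Proof.
move=> q2_gt0 [[solS rK] idc ab [card1 card2] ret2].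
have [/card_gt0P[x0 _] _ br bij_s bij_t] := solS.
have {card2} card_ret : #|Ret S| = q2.
  move: card2; rewrite ret2 divr1 => /eqP.
  by rewrite eqr_int eqz_nat => /eqP.
have {card1} card_S : #|S| = (q1 * q2)%N.
  move: card1; rewrite /ret_card /= card_ret => /eqP.
  have q2_neq0 : (q2%:~R != 0 :> rat)%R by rewrite intr_eq0 eqz_nat -lt0n.
  rewrite -(inj_eq (mulIf q2_neq0)) divfK // -rmorphM /= -PoszM eqr_int eqz_nat.
  by move/eqP.
pose s (x : S) : {perm S} := perm (bij_inj (bij_s x)).
have sigma_s x y : sigma x y = s x y by rewrite permE.
have qmapE (x y : S) : qmap (x, y) = (s x y, tau y x).
  by rewrite -sigma_s /sigma /tau -surjective_pairing.
have s_tau x y : s (s x y) (tau y x) = x.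
  by have := rK (x, y); rewrite qmapE qmapE => -[].
have tauE y x : tau y x = (s (s x y))^-1 x by rewrite -{3}(s_tau x y) permK.
have s_comm x y : commute (s x) (s y).
  pose t (x : S) : {perm S} := perm (bij_inj (bij_t x)).
  have in_G z : (s z, (t z)^-1) \in permutation_group S.
    rewrite mem_gen // inE; apply/existsP; exists z; apply/forallP => w /=.
    by rewrite sigma_s eqxx -[tau z w](permE (bij_inj (bij_t z))) permK eqxx.
  by have [] := centsP ab _ (in_G x) _ (in_G y).
(* First component of the braid equation; products of permutations are read from left to right. *)
have s_s x y : s y * s x = s (tau y x) * s (s x y).
  apply/permP => z; rewrite !permM.
  by have := br (x, y, z); rewrite /r12 /r23 /= !qmapE /= => -[<-].
have s_indep x x' y : s (s x y) = s (s x' y).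
  have [v all_v] : exists v : Ret (Ret S), forall u, u = v.
    by apply/fintype1P/eqP.
  have sigma_pi (u w : S) :
      sigma (\pi_(ret_quot S) u : Ret S) (\pi_(ret_quot S) w) =
      \pi_(ret_quot S) (sigma u w).
    by rewrite {1}/sigma Ret_qmap_pi.
  have /eqmodP/ret_relP[] : \pi_(ret_quot (Ret S)) (\pi_(ret_quot S) x) =
    \pi_(ret_quot (Ret S)) (\pi_(ret_quot S) x') by rewrite !(all_v (\pi _)).
  move=> /(_ (\pi y)); rewrite !sigma_pi => /eqmodP/ret_relP[eq_s _] _.
  by apply/permP => z; rewrite -!sigma_s.
pose Z := s (s x0 x0) * (s x0)^-1.
have ZE x y : s (s x y) * (s y)^-1 = Z.
  have st u w : s (s u w) * (s w)^-1 = s u * (s (tau w u))^-1.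
    apply: (mulIg (s w)); apply: (mulIg (s (tau w u))) => /=.
    rewrite mulgVK -[RHS]mulgA [s w * s (tau w u)]s_comm mulgA mulgVK.
    by rewrite [LHS]s_comm -s_s s_comm.
  (* Choose [u = g x0], so that [tau y u = x0]. By [s_indep] and [st] the ratio equals
     [s u * (s x0)^-1]. Involutivity writes [u] as the image of [x0] under some sigma map, so
     [s u = s (s x0 x0)] by [s_indep] again. *)
  have [g tK gK] := bij_t y.
  rewrite (s_indep _ (g x0)) st gK -(s_tau (g x0) y) gK.
  by rewrite (s_indep _ x0).
suff pres : presented s Z x0 by exists s, Z, x0; rewrite -(card_Ret pres).
split=> // [x y|x y|P Px0 Pcl y].
- by rewrite qmapE tauE -(ZE x y) mulgVK.
- by rewrite -(ZE x y) mulgVK.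
(* The setwise stabiliser of [P] is a group, so it contains the inverses of the [s x] as well. This
   covers the tau maps, whose values are values of such inverses, and transitivity then carries [P]
   from [x0] to all of [S]. *)
have s_stab x : s x \in 'N([set z | P z] | 'P).
  rewrite !inE; apply/subsetP => z; rewrite !inE; exact: Pcl.
have stab : <<translations S>> \subset 'N([set z | P z] | 'P).
  rewrite gen_subG; apply/subsetP => h; rewrite inE => /existsP[x /orP[]] /forallP hx.
    by have -> : h = s x by apply/permP => z; rewrite (eqP (hx z)) sigma_s.
  rewrite !inE; apply/subsetP => z; rewrite !inE /= => Pz.
  rewrite /aperm (eqP (hx z)) tauE.
  have := astabs_act z (groupVr (s_stab (s z x))).
  by rewrite !inE /= /aperm Pz.
have [h Gh ->] := atransP2 idc (in_setT x0) (in_setT y).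
by have := astabs_act x0 (subsetP stab _ Gh); rewrite !inE /= Px0.
Qed.

(** * Solutions are determined by [q1], [q2] and [n] *)

(** Trading [T ^+ q1] for [Z ^+ n] reduces any coordinates to the box ['I_q1 * 'I_q2]. The box maps
    onto [S] and has the same cardinality, so reduced coordinates are unique. *)
Lemma point_eq q1 q2 n (S : quadratic_set) s Z (x0 : S) :
  presented s Z x0 -> #|S| = (q1 * q2)%N -> 0 < q1 -> 0 < q2 ->
  Z ^+ q2 = 1 -> s x0 ^+ q1 = Z ^+ n ->
  forall a b c d, point s Z x0 a b = point s Z x0 c d <->
    (a = c %[mod q1])%N /\ (b + n * (a %/ q1) = d + n * (c %/ q1) %[mod q2])%N.
Proof.
move=> pres cardS q1_gt0 q2_gt0 Zq2 Tq1.
have Tq1X k : s x0 ^+ (q1 * k) = Z ^+ (n * k) by rewrite !expgM Tq1.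
have reduce a b : point s Z x0 a b =
    point s Z x0 (a %% q1) ((b + n * (a %/ q1)) %% q2).
  rewrite /point (expg_mod _ Zq2) addnC expgD mulgA -Tq1X.
  by rewrite -expgD [in RHS]addnC mulnC -divn_eq.
pose box (i : 'I_q1 * 'I_q2) := point s Z x0 i.1 i.2.
have box_inj : injective box.
  have box_surj : box @: setT = setT.
    apply/setP=> y; rewrite [RHS]inE; apply/imsetP.
    have [a [b ->]] := point_surj pres y; rewrite reduce.
    have lt1 : a %% q1 < q1 by rewrite ltn_pmod.
    have lt2 : (b + n * (a %/ q1)) %% q2 < q2 by rewrite ltn_pmod.
    by exists (Ordinal lt1, Ordinal lt2).
  have /imset_injP inj : #|box @: setT| == #|[set: 'I_q1 * 'I_q2]|.
    by rewrite box_surj !cardsT card_prod !card_ord cardS.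
  by move=> i j; apply: inj; rewrite inE.
move=> a b c d; rewrite (reduce a) (reduce c); split=> [eq_pt | [-> ->] //].
have lt1 k : k %% q1 < q1 by rewrite ltn_pmod.
have lt2 k : k %% q2 < q2 by rewrite ltn_pmod.
by have [] := box_inj (Ordinal (lt1 _), Ordinal (lt2 _))
                      (Ordinal (lt1 _), Ordinal (lt2 _)) eq_pt.
Qed.

(** The criterion of [point_eq] mentions only [q1], [q2] and [n], so matching points with equal
    coordinates is well defined and injective. *)
Lemma presented_isomorphic q1 q2 n (S S' : quadratic_set) s Z (x0 : S)
    s' Z' (x0' : S') :
  presented s Z x0 -> presented s' Z' x0' ->
  #|S| = (q1 * q2)%N -> #|S'| = (q1 * q2)%N -> 0 < q1 -> 0 < q2 ->
  Z ^+ q2 = 1 -> Z' ^+ q2 = 1 -> s x0 ^+ q1 = Z ^+ n -> s' x0' ^+ q1 = Z' ^+ n ->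
  isomorphic S S'.
Proof.
move=> pres pres' cardS cardS' q1_gt0 q2_gt0 Zq2 Z'q2 Tq1 T'q1.
have ptE a b c d : point s Z x0 a b = point s Z x0 c d <->
    point s' Z' x0' a b = point s' Z' x0' c d.
  rewrite (point_eq pres cardS q1_gt0 q2_gt0 Zq2 Tq1).
  by rewrite (point_eq pres' cardS' q1_gt0 q2_gt0 Z'q2 T'q1).
have /choice[h hE] y : exists ab, y = point s Z x0 ab.1 ab.2.
  by have [a [b ->]] := point_surj pres y; exists (a, b).
pose f y := point s' Z' x0' (h y).1 (h y).2.
have fE a b : f (point s Z x0 a b) = point s' Z' x0' a b.
  by apply/ptE; rewrite -hE.
have f_inj : injective f by move=> x y /ptE; rewrite -!hE.
have f_bij : bijective f by apply: inj_card_bij; rewrite // cardS cardS'.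
(* The case [k = 0] serves the first component of [qmap], the case [k = 1] the second. *)
have fs k a b y : f ((Z ^+ k * s (point s Z x0 a b)) y) =
    (Z' ^+ k * s' (point s' Z' x0' a b)) (f y).
  have [c [d ->]] := point_surj pres y.
  rewrite fE (s_point pres) (s_point pres') !mulgA -!expgD.
  by rewrite (act_point pres) (act_point pres') fE.
exists f => // -[x y] /=.
have [[qE _ _ _] [qE' _ _ _]] := (pres, pres').
rewrite qE qE' /=; congr (_, _).
  have [a [b ->]] := point_surj pres x.
  by rewrite -[s _]mul1g (fs 0) expg0 mul1g fE.
apply: (can_inj (permK (Z' * s' (f y)))); rewrite permKV.
have [a [b ->]] := point_surj pres y.
by rewrite fE -[Z']expg1 -fs expg1 permKV.
Qed.

(** * Invariance of the order of [Z] and of the exponent [n] *)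

Section Isomorphism.

Variables (S S' : quadratic_set) (s : S -> {perm S}) (s' : S' -> {perm S'}).
Variables (Z : {perm S}) (Z' : {perm S'}) (x0 : S) (x0' : S') (f : S -> S').
Hypotheses (pres : presented s Z x0) (pres' : presented s' Z' x0').
Hypothesis f_bij : bijective f.
Hypothesis f_qmap : forall u, (f (qmap u).1, f (qmap u).2) = qmap (f u.1, f u.2).

Let f_s k x y : f ((s x ^+ k) y) = (s' (f x) ^+ k) (f y).
Proof.
have f_s1 z : f (s x z) = s' (f x) (f z).
  have [[qE _ _ _] [qE' _ _ _]] := (pres, pres').
  by have := f_qmap (x, z); rewrite qE qE' => -[].
elim: k => [|k IHk]; first by rewrite !perm1.
by rewrite !expgSr !permM f_s1 IHk.
Qed.

Let f_Z k y : f ((Z ^+ k) y) = (Z' ^+ k) (f y).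
Proof.
have f_Z1 z : f (Z z) = Z' (f z).
  have [[_ _ ss _] [_ _ ss' _]] := (pres, pres').
  (* Only the sigma maps are known to be transported by [f], so [Z] is first completed to
     [Z * s x0 = s (s x0 x0)]. *)
  apply: (@perm_inj _ (s' (f x0))).
  have fs x w : f (s x w) = s' (f x) (f w) by apply: (f_s 1).
  by rewrite -[RHS]permM -(ss' (f x0)) -!fs -permM -(ss x0).
elim: k => [|k IHk]; first by rewrite !perm1.
by rewrite !expgSr !permM f_Z1 IHk.
Qed.

Lemma isomorphic_order : #[Z] = #[Z'].
Proof.
have [f' fK f'K] := f_bij.
apply/eqP; rewrite eqn_dvd !order_dvdn; apply/andP; split; apply/eqP/permP=> y.
  by apply: (can_inj fK); rewrite f_Z expg_order !perm1.
by rewrite -[y]f'K -f_Z expg_order !perm1.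
Qed.

(* [f x0] need not be [x0'], but [s' (f x0)] and [s' x0'] differ by a power of
   [Z'], which the [q]-th power kills. *)
Lemma isomorphic_exp q n :
  #[Z'] %| q -> s x0 ^+ q = Z ^+ n -> s' x0' ^+ q = Z' ^+ n.
Proof.
move=> dvd_q Tq; have [f' fK f'K] := f_bij.
have <- : s' (f x0) ^+ q = Z' ^+ n.
  by apply/permP=> y; rewrite -[y]f'K -f_s -f_Z Tq.
have [a ->] := presented_sE pres' (f x0).
have cTZ := commTZ pres' 1 a.
rewrite expgMn; last exact/commute_sym.
move: dvd_q; rewrite -expgM mulnC expgM order_dvdn => /eqP->.
by rewrite expg1n mul1g.
Qed.

End Isomorphism.

(** * The solution on the lattice quotient *)

Section LatticeSolution.

Variables (p : nat) (p_pr : prime p) (d1 d2 m : nat).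

Local Notation A := (lattice_quot d1 d2 m p_pr).
Local Notation q1 := (p ^ d1)%N.
Local Notation q2 := (p ^ d2)%N.
Local Notation c := (p ^ (d1 - d2))%N.

Local Open Scope ring_scope.

Definition lattice_pt (a b : int) : A := \pi_A (a, b).
Local Notation cls := lattice_pt.

Let q1_gt0 : (0 < q1)%N. Proof. by rewrite expn_gt0 prime_gt0. Qed.
Let q2_gt0 : (0 < q2)%N. Proof. by rewrite expn_gt0 prime_gt0. Qed.

Lemma lattice_ptP (a b a' b' : int) :
  cls a b = cls a' b' <->
  exists k l : int, a = a' + k * q1%:Z /\ b = b' + k * m%:Z + l * q2%:Z.
Proof.
have pairMz (u : int * int) (z : int) : u *~ z = (z * u.1, z * u.2).
  rewrite [LHS]surjective_pairing (raddfMz fst) (raddfMz snd).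
  by rewrite /= !mulrzz ![z * _]mulrC.
split=> [/eqP | [k [l [-> ->]]]].
  rewrite -Quotient.idealrBE => /asboolP[e].
  rewrite big_ord_recl big_ord1 /= !pairMz /= => -[ea eb].
  exists (e ord0), (e (lift ord0 ord0)); split.
    by rewrite -[a](subrK a') ea; ring.
  by rewrite -[b](subrK b') eb; ring.
apply/eqP; rewrite -Quotient.idealrBE; apply/asboolP.
exists [ffun n : 'I_2 => [:: k; l]`_n].
rewrite big_ord_recl big_ord1 !ffunE /= !pairMz; congr (_, _); rewrite /=; ring.
Qed.

(** The generators of the lattice are triangular: for two points of the box, the first coordinate
    forces [k = 0] and then the second forces [l = 0]. *)
Lemma card_lattice_quot : #|{: A}| = (q1 * q2)%N.
Proof.
have inj : injective (@lattice_class p p_pr d1 d2 m).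
  move=> [i j] [i' j'] /lattice_ptP[k [l [/= ei ej]]].
  have [lti lti' ltj ltj'] :=
    And4 (ltn_ord i) (ltn_ord i') (ltn_ord j) (ltn_ord j').
  have k0 : k = 0 by nia.
  have l0 : l = 0 by rewrite k0 in ej; nia.
  rewrite k0 l0 in ei ej; congr (_, _); apply: val_inj => /=; lia.
rewrite -[RHS](_ : #|{: 'I_q1 * 'I_q2}| = _); last by rewrite card_prod !card_ord.
rewrite -(card_codom inj); apply: eq_card => x.
by rewrite lattice_class_surj.
Qed.

Hypothesis le_d : (d2 <= d1)%N.

Let q1E : q1%:Z = c%:Z * q2%:Z.
Proof. by rewrite -PoszM -expnD subnK. Qed.

(** Shifting the first coordinate of either argument by [q1] adds an extra [q1] to the second
    coordinate of the value; this is harmless because [q2] divides [q1]. The witnesses below record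
    it through [c = q1 / q2]. *)
Lemma lattice_sigma_exists : exists s : A -> {perm A}, lattice_sigma s.
Proof.
pose f (x y : A) : A :=
  cls ((repr y).1 + 1) ((repr x).1 + (repr y).1 + (repr y).2).
have fE a1 a2 b1 b2 : f (cls a1 a2) (cls b1 b2) = cls (b1 + 1) (a1 + b1 + b2).
  rewrite /f; case E: (repr (cls a1 a2)) => [a1' a2'].
  case F: (repr (cls b1 b2)) => [b1' b2'] /=.
  have /lattice_ptP[k [l [-> ea]]] : cls a1' a2' = cls a1 a2.
    by rewrite /lattice_pt -E reprK.
  have /lattice_ptP[k' [l' [-> ->]]] : cls b1' b2' = cls b1 b2.
    by rewrite /lattice_pt -F reprK.
  apply/lattice_ptP; exists k', (l' + (k + k') * c%:Z); rewrite q1E.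
  by split; ring.
have f_inj x : injective (f x).
  move=> y z; rewrite -[x]reprK -[y]reprK -[z]reprK.
  case: (repr x) (repr y) (repr z) => [a1 a2] [b1 b2] [e1 e2].
  rewrite !fE => /lattice_ptP[k [l [E F]]].
  apply/lattice_ptP; exists k, (l - k * c%:Z).
  have -> : b1 = e1 + k * q1%:Z by lia.
  split=> //; have -> : b2 = b2 + (a1 + b1) - (a1 + b1) by ring.
  have -> : b2 + (a1 + b1) = a1 + b1 + b2 by ring.
  rewrite F; have -> : b1 = e1 + k * q1%:Z by lia.
  by rewrite q1E; ring.
by exists (fun x => perm (@f_inj x)) => -[a1 a2] [b1 b2]; rewrite permE fE.
Qed.

Variable s : A -> {perm A}.
Hypothesis sE : lattice_sigma s.

Let scls a1 a2 b1 b2 : s (cls a1 a2) (cls b1 b2) = cls (b1 + 1) (a1 + b1 + b2).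
Proof. exact: (sE (a1, a2) (b1, b2)). Qed.

Let clsP x : exists a b, x = cls a b.
Proof.
by exists (repr x).1, (repr x).2; rewrite /lattice_pt -surjective_pairing reprK.
Qed.

(** Here [cls 1 0] is the image of the base point [cls 0 0] under its own sigma map. Being a
    quotient of sigma maps, [Z] preserves every predicate that they preserve. *)
Definition lattice_Z : {perm A} := ((s (cls 0 0))^-1 * s (cls 1 0))%g.
Local Notation Z := lattice_Z.

Lemma lattice_ZE k a b : (Z ^+ k)%g (cls a b) = cls a (b + k%:Z).
Proof.
elim: k => [|k IHk]; first by rewrite perm1 addr0.
rewrite expgSr permM IHk /lattice_Z permM.
have -> : cls a (b + k%:Z) = s (cls 0 0) (cls (a - 1) (b + k%:Z - (a - 1))).
  by rewrite scls; congr cls; ring.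
by rewrite permK scls; congr cls; rewrite -?[k.+1]addn1 ?PoszD; ring.
Qed.

(** The step number [j], counted from 0, adds the current first coordinate [a + j] to the second
    one; summing over [j < k] gives the binomial. *)
Lemma lattice_TE k a b :
  (s (cls 0 0) ^+ k)%g (cls a b) = cls (a + k%:Z) (b + k%:Z * a + 'C(k, 2)%:Z).
Proof.
elim: k => [|k IHk]; first by rewrite perm1 mul0r !addr0.
rewrite expgSr permM IHk scls binS bin1 -addn1 !PoszD; congr cls; ring.
Qed.

Lemma lattice_presented :
  presented (S := involutive_qset s) s Z (cls 0 0).
Proof.
have s_s (x y : A) : s (s x y) = (Z * s y)%g.
  apply/permP=> z; have [[a1 [a2 ->]] [b1 [b2 ->]] [e1 [e2 ->]]] :=
    And3 (clsP x) (clsP y) (clsP z).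
  rewrite permM -[Z]expg1 lattice_ZE !scls; congr cls; ring.
split=> [x y|x y|x y|P P0 clos y] //=.
- by rewrite s_s.
- apply/permP=> z; have [[a1 [a2 ->]] [b1 [b2 ->]] [e1 [e2 ->]]] :=
    And3 (clsP x) (clsP y) (clsP z).
  rewrite !permM !scls; congr cls; ring.
have closX x k z : P z -> P ((s x ^+ k)%g z).
  move=> Pz; elim: k => [|k IHk]; first by rewrite perm1.
  by rewrite expgSr permM clos.
have closZ z : P z -> P (Z z).
  move=> Pz; rewrite /lattice_Z permM; apply: clos.
  by rewrite invg_expg; apply: closX.
have closZX k z : P z -> P ((Z ^+ k)%g z).
  move=> Pz; elim: k => [|k IHk]; first by rewrite perm1.
  by rewrite expgSr permM closZ.
have /codomP[[i j] ->] := lattice_class_surj y.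
(* [T ^+ i] leads from the origin to [(i, 'C(i, 2))]. The multiple [q2.-1] plays the role of -1
   modulo [q2], removing the binomial with a natural exponent. *)
have := closZX (j + q2.-1 * 'C(i, 2))%N _ (closX (cls 0 0) i _ P0).
rewrite lattice_TE lattice_ZE; congr (P _); apply/lattice_ptP.
exists 0, 'C(i, 2)%:Z; have : q2%:Z = q2.-1%:Z + 1 by lia.
move=> ->; split=> /=; first by ring.
by rewrite PoszD PoszM; ring.
Qed.

Lemma lattice_order : #[Z]%g = q2.
Proof.
have dvdP k : (#[Z]%g %| k)%N = (q2 %| k)%N.
  rewrite order_dvdn; apply/eqP/idP => [Zk1 | /dvdnP[e ->]].
    have := lattice_ZE k 0 0; rewrite Zk1 perm1 => /lattice_ptP[i [l [E F]]].
    have i0 : i = 0 by nia.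
    apply/dvdnP; exists `|l|%N; rewrite i0 in F; nia.
  apply/permP => x; have [a [b ->]] := clsP x.
  rewrite perm1 lattice_ZE; apply/lattice_ptP; exists 0, e%:Z.
  by rewrite PoszM; split; ring.
by apply/eqP; rewrite eqn_dvd dvdP dvdnn -dvdP dvdnn.
Qed.

(** The generator [(q1, m)] of the lattice absorbs the shift by [q1] together with [Z ^+ m], and the
    term [q1 * a] of [lattice_TE] vanishes modulo [q2]. *)
Lemma lattice_exp :
  (s (cls 0 0) ^+ q1 * Z ^+ m = Z ^+ 'C(q1, 2))%g.
Proof.
apply/permP => x; have [a [b ->]] := clsP x.
rewrite permM lattice_TE !lattice_ZE; apply/lattice_ptP.
exists 1, (c%:Z * a); rewrite !q1E; split; ring.
Qed.

End LatticeSolution.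

(* Existence and uniqueness of the parameters *)
Local Close Scope group_scope.
Local Close Scope quotient_scope.

Theorem theorem7p27 (p : nat) (p_pr : prime p) :
  (forall d1 d2 m : nat, d2 <= d1 -> m < p ^ d2 ->
     exists2 s : lattice_quot d1 d2 m p_pr -> {perm lattice_quot d1 d2 m p_pr},
       lattice_sigma s & AbSol (p ^ d1) (p ^ d2) (involutive_qset s)) /\
  (forall d1 d2 : nat, d2 <= d1 ->
     forall S : quadratic_set, AbSol (p ^ d1) (p ^ d2) S ->
     exists! t : nat * nat * nat,
       let: (e1, e2, m) := t in
       [/\ e2 <= e1, m < p ^ e2
         & exists2 s : lattice_quot e1 e2 m p_pr ->
                       {perm lattice_quot e1 e2 m p_pr},
             lattice_sigma s & isomorphic S (involutive_qset s)]).
Proof.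
have pX_gt0 d : 0 < p ^ d by rewrite expn_gt0 prime_gt0.
split=> [d1 d2 m le_d _ | d1 d2 le_d S absS].
  have [s sE] := lattice_sigma_exists p_pr m le_d; exists s => //.
  have pres := lattice_presented le_d sE.
  apply: (presented_AbSol pres).
    exact: card_lattice_quot.
  exact: lattice_order.
have [s [Z [x0 [pres cardS ordZ]]]] := AbSol_presented (pX_gt0 d2) absS.
have /cycleP[n Tn] := presented_exp_index pres cardS ordZ.
(* The residue of ['C(p ^ d1, 2) - n], as [lattice_exp] demands, without subtraction on [nat]. *)
pose m0 := ('C(p ^ d1, 2) + (p ^ d2).-1 * n) %% p ^ d2.
have m0_lt : m0 < p ^ d2 by rewrite ltn_pmod.
have m0E : (n + m0 = 'C(p ^ d1, 2) %[mod p ^ d2])%N.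
  rewrite modnDmr addnCA -[X in _ + (X + _)]mul1n -mulnDl add1n prednK //.
  by rewrite addnC mulnC modnMDl.
exists (d1, d2, m0); split.
  split=> //; have [s' s'E] := lattice_sigma_exists p_pr m0 le_d; exists s' => //.
  have ordZ' := lattice_order le_d s'E.
  have Z'q2 : (lattice_Z s' ^+ (p ^ d2) = 1)%g.
    by rewrite -[in X in (_ ^+ X)%g]ordZ' expg_order.
  apply: (presented_isomorphic pres (lattice_presented le_d s'E) cardS
    (card_lattice_quot _ _ _ _) _ _ _ Z'q2 Tn) => //.
    by rewrite -ordZ expg_order.
  apply: (mulIg (lattice_Z s' ^+ m0)%g); rewrite /= (lattice_exp le_d s'E) -expgD //.
  by apply/eqP; rewrite eq_expg_mod_order ordZ' m0E.
move=> [[e1 e2] m] [le_e m_lt [s' s'E [f f_bij f_qmap]]].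
have pres' := lattice_presented le_e s'E.
(* The order of [Z] recovers [d2], and the cardinality then recovers [d1]. *)
have e2E : d2 = e2.
  apply: (expnI (prime_gt1 p_pr)).
  rewrite -ordZ -(lattice_order le_e s'E).
  exact: isomorphic_order pres pres' f_bij f_qmap.
have e1E : d1 = e1.
  apply: (expnI (prime_gt1 p_pr)); apply/eqP.
  rewrite -(eqn_pmul2r (pX_gt0 d2)) -cardS e2E -(card_lattice_quot p_pr e1 e2 m).
  by apply/eqP; exact: bij_eq_card f_bij.
subst e1 e2; congr (_, _, _).
have ordZ' := lattice_order le_d s'E.
have dvdZ' : #[lattice_Z s']%g %| p ^ d1 by rewrite ordZ' dvdn_exp2l.
have T'n := isomorphic_exp pres pres' f_bij f_qmap dvdZ' Tn.
(* This gives [n + m = n + m0] modulo [p ^ d2], and both [m] and [m0] are reduced. *)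
have /eqP := lattice_exp le_d s'E.
rewrite T'n -expgD eq_expg_mod_order ordZ' -m0E eqn_modDl !modn_small //.
by move/eqP.
Qed.
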